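(* Let $n\ge 1$. Let $e\in B(\tilde A_n)$ be the element $$e=a_{n+1}^{-1}\,\sigma_n^{-1}\sigma_{n-1}^{-1}\cdots\sigma_2^{-1}\,\sigma_1\,\sigma_2\cdots\sigma_{n-1}\sigma_n,$$ let $N_e$ be the normal subgroup of $B(\tilde A_n)$ generated by $e$ (the normal closure of $e$), and let $Q=B(\tilde A_n)/N_e$. Then the map $f:Q\to B(A_n)$ defined by $$\sigma_i\mapsto\sigma_i\ (1\le i\le n),\qquad a_{n+1}\mapsto \sigma_n^{-1}\sigma_{n-1}^{-1}\cdots\sigma_2^{-1}\,\sigma_1\,\sigma_2\cdots\sigma_{n-1}\sigma_n$$ is a (well-defined) group isomorphism.
   Context: $B(A_n)$ is the group with generators $\sigma_1,\dots,\sigma_n$ and relations $\sigma_i\sigma_j=\sigma_j\sigma_i$ for $|i-j|\ge 2$ and $\sigma_i\sigma_{i+1}\sigma_i=\sigma_{i+1}\sigma_i\sigma_{i+1}$ for $1\le i\le n-1$ (the braid group on $n+1$ strands). For $n\ge 2$, $B(\tilde A_n)$ is the group with generators $\sigma_1,\dots,\sigma_n,a_{n+1}$ and relations: $\sigma_i\sigma_j=\sigma_j\sigma_i$ for $1\le i,j\le n$, $|i-j|\ge2$; $\sigma_i\sigma_{i+1}\sigma_i=\sigma_{i+1}\sigma_i\sigma_{i+1}$ for $1\le i\le n-1$; $\sigma_i a_{n+1}=a_{n+1}\sigma_i$ for $2\le i\le n-1$; $\sigma_1a_{n+1}\sigma_1=a_{n+1}\sigma_1a_{n+1}$; $\sigma_na_{n+1}\sigma_n=a_{n+1}\sigma_na_{n+1}$.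 For $n=1$, $B(\tilde A_1)$ is the free group on $\sigma_1,a_2$. In $Q$, the symbols $\sigma_i$ and $a_{n+1}$ denote the images of the corresponding generators of $B(\tilde A_n)$. *)

(* Defs.v *)
From HB Require Import structures.
From mathcomp Require Import all_boot.
From mathcomp Require Import boolp classical_sets.

Set Implicit Arguments.
Unset Strict Implicit.
Unset Printing Implicit Defensive.

Local Open Scope quotient_scope.
Local Open Scope classical_set_scope.
Local Open Scope group_scope.

(* The letter (x, false) stands for the generator x, and (x, true) for its inverse. *)
Definition word (X : Type) := seq (X * bool).

Definition positive_word (X : Type) (s : seq X) : word X :=
  [seq (x, false) | x <- s].

Definition inverse_word (X : Type) (w : word X) : word X :=
  rev [seq (p.1, ~~ p.2) | p <- w].

Inductive word_cong (X : Type) (R : word X -> word X -> Prop) :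
    word X -> word X -> Prop :=
| word_cong_refl u : word_cong R u u
| word_cong_sym u v : word_cong R u v -> word_cong R v u
| word_cong_trans u v w :
    word_cong R u v -> word_cong R v w -> word_cong R u w
| word_cong_cat u u' v v' :
    word_cong R u u' -> word_cong R v v' -> word_cong R (u ++ v) (u' ++ v')
| word_cong_cancel x b : word_cong R [:: (x, b); (x, ~~ b)] [::]
| word_cong_rel u v : R u v -> word_cong R u v.

Section Presented.
Variables (X : choiceType) (R : word X -> word X -> Prop).

Definition word_congb : rel (word X) := fun u v => `[< word_cong R u v >].

Lemma word_congb_refl : reflexive word_congb.
Proof. by move=> u; apply/asboolP; apply: word_cong_refl. Qed.

Lemma word_congb_sym : symmetric word_congb.
Proof. by move=> u v; apply/asboolP/asboolP => /word_cong_sym. Qed.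

Lemma word_congb_trans : transitive word_congb.
Proof.
by move=> v u w /asboolP uv /asboolP vw; apply/asboolP; apply: word_cong_trans vw.
Qed.

Canonical word_congb_equiv :=
  EquivRel word_congb word_congb_refl word_congb_sym word_congb_trans.

Definition presented := {eq_quot word_congb}.

HB.instance Definition _ := EqQuotient.on presented.
HB.instance Definition _ := Choice.on presented.

Implicit Types (u v w : word X) (x y z : presented).

Lemma presentedP u v : reflect (word_cong R u v) (\pi_presented u == \pi v).
Proof. by rewrite piE; apply: asboolP. Qed.

Lemma word_cong_pi u v : \pi_presented u = \pi v <-> word_cong R u v.
Proof. by split=> [/eqP/presentedP //|/presentedP/eqP]. Qed.

Lemma word_cong_repr u : word_cong R (repr (\pi_presented u)) u.
Proof. by apply/word_cong_pi; rewrite reprK. Qed.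

Lemma inverse_wordK : involutive (@inverse_word X).
Proof.
move=> u; rewrite /inverse_word map_rev revK -map_comp -[RHS]map_id.
by apply: eq_map => -[x b] /=; rewrite negbK.
Qed.

Lemma inverse_word_cat u v :
  inverse_word (u ++ v) = inverse_word v ++ inverse_word u.
Proof. by rewrite /inverse_word map_cat rev_cat. Qed.

Lemma word_cong_catV u : word_cong R (u ++ inverse_word u) [::].
Proof.
elim: u => [|[x b] u IH] /=; first exact: word_cong_refl.
rewrite (inverse_word_cat [:: _]) -/(cat [:: (x, b)] _) catA.
apply: word_cong_trans (word_cong_cancel R x b).
rewrite -cat1s -[[:: _; _]]/([:: _] ++ [::] ++ [:: _]) -catA.
apply: word_cong_cat (word_cong_refl _ _) _.
by rewrite catA; apply: (word_cong_cat IH (word_cong_refl _ _)).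
Qed.

Lemma word_cong_Vcat u : word_cong R (inverse_word u ++ u) [::].
Proof. by rewrite -{2}[u]inverse_wordK; apply: word_cong_catV. Qed.

Lemma word_cong_inverse u v :
  word_cong R u v -> word_cong R (inverse_word u) (inverse_word v).
Proof.
move=> uv; apply: (@word_cong_trans _ _ _ (inverse_word u ++ (v ++ inverse_word v))).
  rewrite -{1}[inverse_word u]cats0; apply: word_cong_cat (word_cong_refl _ _) _.
  exact/word_cong_sym/word_cong_catV.
rewrite catA -{2}[inverse_word v]cat0s.
apply: word_cong_cat (word_cong_refl _ _).
apply: word_cong_trans (word_cong_Vcat u).
exact: word_cong_cat (word_cong_refl _ _) (word_cong_sym uv).
Qed.

Definition presented_one : presented := \pi_presented [::].
Definition presented_mul x y : presented := \pi_presented (repr x ++ repr y).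
Definition presented_inv x : presented := \pi_presented (inverse_word (repr x)).

Lemma pi_cat u v : presented_mul (\pi u) (\pi v) = \pi_presented (u ++ v).
Proof. by apply/word_cong_pi/word_cong_cat; apply: word_cong_repr. Qed.

Lemma pi_inverse_word u : presented_inv (\pi u) = \pi_presented (inverse_word u).
Proof. exact/word_cong_pi/word_cong_inverse/word_cong_repr. Qed.

Lemma presented_mulA : associative presented_mul.
Proof.
by elim/quotW=> u; elim/quotW=> v; elim/quotW=> w; rewrite !pi_cat catA.
Qed.

Lemma presented_mul1 : left_id presented_one presented_mul.
Proof. by elim/quotW=> u; rewrite pi_cat. Qed.

Lemma presented_mulr1 : right_id presented_one presented_mul.
Proof. by elim/quotW=> u; rewrite pi_cat cats0. Qed.

Lemma presented_mulV : left_inverse presented_one presented_inv presented_mul.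
Proof.
elim/quotW=> u; rewrite pi_inverse_word pi_cat; apply/word_cong_pi.
exact: word_cong_Vcat.
Qed.

Lemma presented_mulrV : right_inverse presented_one presented_inv presented_mul.
Proof.
elim/quotW=> u; rewrite pi_inverse_word pi_cat; apply/word_cong_pi.
exact: word_cong_catV.
Qed.

HB.instance Definition _ := isGroup.Build presented
  presented_mulA presented_mul1 presented_mulr1 presented_mulV presented_mulrV.

Definition presented_gen (g : X) : presented := \pi_presented (positive_word [:: g]).

End Presented.

Definition normal_subgroup (G : groupType) (N : set G) : Prop :=
  [/\ N 1, forall x y, N x -> N y -> N (x / y)
    & forall x y, N x -> N (x ^ y)].

Record normalSubgroup (G : groupType) := NormalSubgroup {
  normal_set : set G;
  normal_setP : normal_subgroup normal_set }.

Lemma smallest_normal_subgroup (G : groupType) (A : set G) :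
  normal_subgroup (smallest (@normal_subgroup G) A).
Proof.
split=> [N [[]] //|x y Nx Ny N NA|x y Nx N NA].
  by case: (NA) => -[_ + _] _; apply; [apply: Nx | apply: Ny].
by case: (NA) => -[_ _ +] _; apply; apply: Nx.
Qed.

Definition normal_closure (G : groupType) (A : set G) : normalSubgroup G :=
  NormalSubgroup (smallest_normal_subgroup A).

Section Quotient.
Variables (G : groupType) (N : normalSubgroup G).
Implicit Types x y z : G.

Definition coset_rel : rel G := fun x y => `[< normal_set N (x^-1 * y) >].

Let N1 : normal_set N 1. Proof. by case: (normal_setP N). Qed.

Let NF x y : normal_set N x -> normal_set N y -> normal_set N (x / y).
Proof. by case: (normal_setP N) => _ + _; apply. Qed.

Let NJ x y : normal_set N x -> normal_set N (x ^ y).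
Proof. by case: (normal_setP N) => _ _; apply. Qed.

Let NV x : normal_set N x -> normal_set N x^-1.
Proof. by move=> Nx; rewrite -[_^-1]mul1g; apply: NF. Qed.

Let NM x y : normal_set N x -> normal_set N y -> normal_set N (x * y).
Proof. by move=> Nx /NV Ny; rewrite -[y]invgK; apply: NF. Qed.

Lemma coset_rel_refl : reflexive coset_rel.
Proof. by move=> x; apply/asboolP; rewrite mulVg. Qed.

Lemma coset_rel_sym : symmetric coset_rel.
Proof.
by move=> x y; apply/asboolP/asboolP => /NV; rewrite invgM invgK.
Qed.

Lemma coset_rel_trans : transitive coset_rel.
Proof.
move=> y x z /asboolP xy /asboolP yz; apply/asboolP.
by have := NM xy yz; rewrite -mulgA mulVKg.
Qed.

Canonical coset_rel_equiv :=
  EquivRel coset_rel coset_rel_refl coset_rel_sym coset_rel_trans.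

Definition quotient := {eq_quot coset_rel}.

HB.instance Definition _ := EqQuotient.on quotient.
HB.instance Definition _ := Choice.on quotient.

Definition coset x : quotient := \pi x.

Lemma eq_coset x y : coset x = coset y <-> normal_set N (x^-1 * y).
Proof.
rewrite /coset; split=> [/eqP|Nxy]; last apply/eqP; rewrite piE.
  by move/asboolP.
exact/asboolP.
Qed.

Definition quotient_one : quotient := coset 1.
Definition quotient_mul (a b : quotient) : quotient := coset (repr a * repr b).
Definition quotient_inv (a : quotient) : quotient := coset (repr a)^-1.

Let repr_coset x : normal_set N (x^-1 * repr (coset x)).
Proof. by apply/eq_coset; rewrite /coset reprK. Qed.

Lemma quotient_mulE x y : quotient_mul (coset x) (coset y) = coset (x * y).
Proof.
apply/esym/eq_coset; have xP := repr_coset x; have yP := repr_coset y.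
have := NM (NJ y xP) yP.
by rewrite /conjg invgM !mulgA mulgK.
Qed.

Lemma quotient_invE x : quotient_inv (coset x) = coset x^-1.
Proof.
apply/eq_coset; rewrite invgK.
by have := NJ x^-1 (repr_coset x); rewrite /conjg invgK !mulgA mulgV mul1g.
Qed.

Lemma quotient_mulA : associative quotient_mul.
Proof.
elim/quotW=> x; elim/quotW=> y; elim/quotW=> z.
by rewrite -!/(coset _) !quotient_mulE mulgA.
Qed.

Lemma quotient_mul1 : left_id quotient_one quotient_mul.
Proof. by elim/quotW=> x; rewrite -/(coset _) quotient_mulE mul1g. Qed.

Lemma quotient_mulr1 : right_id quotient_one quotient_mul.
Proof. by elim/quotW=> x; rewrite -/(coset _) quotient_mulE mulg1. Qed.

Lemma quotient_mulV : left_inverse quotient_one quotient_inv quotient_mul.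
Proof.
by elim/quotW=> x; rewrite -/(coset _) quotient_invE quotient_mulE mulVg.
Qed.

Lemma quotient_mulrV : right_inverse quotient_one quotient_inv quotient_mul.
Proof.
by elim/quotW=> x; rewrite -/(coset _) quotient_invE quotient_mulE mulgV.
Qed.

HB.instance Definition _ := isGroup.Build quotient
  quotient_mulA quotient_mul1 quotient_mulr1 quotient_mulV quotient_mulrV.

Lemma cosetM : {morph coset : x y / x * y}.
Proof. by move=> x y; rewrite -quotient_mulE. Qed.

HB.instance Definition _ := isMultiplicative.Build G quotient coset cosetM.

End Quotient.

(* The indices 1, ..., n are shifted to 'I_n: sigma_i is written              *)
(* [sigma (i - 1)]. In the affine case [None] names the generator a_{n+1}.    *)

Definition far (i j : nat) : bool := (i.+1 < j)%N || (j.+1 < i)%N.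

Inductive braid_rel (n : nat) : word 'I_n -> word 'I_n -> Prop :=
| braid_comm (i j : 'I_n) : far i j ->
    braid_rel (positive_word [:: i; j]) (positive_word [:: j; i])
| braid_braid (i j : 'I_n) : j = i.+1 :> nat ->
    braid_rel (positive_word [:: i; j; i]) (positive_word [:: j; i; j]).

Definition braid_group (n : nat) : groupType := presented (@braid_rel n).

Definition sigma (n : nat) (i : 'I_n) : braid_group n :=
  presented_gen (@braid_rel n) i.

(* No constructor applies when n = 1, so the group presented is then free on  *)
(* the two generators.                                                        *)
Inductive affine_braid_rel (n : nat) :
    word (option 'I_n) -> word (option 'I_n) -> Prop :=
| affine_comm (i j : 'I_n) : far i j ->
    affine_braid_rel (positive_word [:: Some i; Some j])
                     (positive_word [:: Some j; Some i])
| affine_braid (i j : 'I_n) : j = i.+1 :> nat ->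
    affine_braid_rel (positive_word [:: Some i; Some j; Some i])
                     (positive_word [:: Some j; Some i; Some j])
| affine_comm_a (i : 'I_n) : (0 < i)%N -> (i.+1 < n)%N ->
    affine_braid_rel (positive_word [:: Some i; None])
                     (positive_word [:: None; Some i])
| affine_braid_first_a (i : 'I_n) : (1 < n)%N -> i = 0 :> nat ->
    affine_braid_rel (positive_word [:: Some i; None; Some i])
                     (positive_word [:: None; Some i; None])
| affine_braid_last_a (i : 'I_n) : (1 < n)%N -> i.+1 = n ->
    affine_braid_rel (positive_word [:: Some i; None; Some i])
                     (positive_word [:: None; Some i; None]).

Definition affine_braid_group (n : nat) : groupType :=
  presented (@affine_braid_rel n).

Definition affine_sigma (n : nat) (i : 'I_n) : affine_braid_group n :=
  presented_gen (@affine_braid_rel n) (Some i).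

Definition affine_a (n : nat) : affine_braid_group n :=
  presented_gen (@affine_braid_rel n) None.

(* s_n^-1 s_(n-1)^-1 ... s_2^-1 s_1 s_2 ... s_n, with the indices shifted to  *)
(* 'I_n: the first product is decreasing and skips the index 0.               *)
Definition conj_first (G : groupType) (n : nat) (s : 'I_n -> G) : G :=
  (\prod_(i <- rev (enum 'I_n) | (0 < i)%N) (s i)^-1) * \prod_(i < n) s i.

Definition elt_e (n : nat) : affine_braid_group n :=
  (affine_a n)^-1 * conj_first (@affine_sigma n).

Definition N_e (n : nat) : normalSubgroup (affine_braid_group n) :=
  normal_closure [set elt_e n].

Definition Q (n : nat) : groupType := quotient (N_e n).

(* Main.v *)
Require Import Defs.
From HB Require Import structures.
From mathcomp Require Import all_boot.
From mathcomp Require Import boolp classical_sets.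

Set Implicit Arguments.
Unset Strict Implicit.
Unset Printing Implicit Defensive.

Local Open Scope group_scope.

(** Killing e means imposing a_(n+1) = A, where A is the conjugate of s_1 by
    s_2 ... s_n. This eliminates the generator a_(n+1) from the presentation of
    B(~A_n) and leaves the generators s_1, ..., s_n with the relations of
    B(A_n) and those obtained from the remaining affine relations by replacing
    a_(n+1) by A. So everything rests on showing that the latter already hold
    in B(A_n) ([affine_rel_conj_first]); the two universal properties
    ([presented_lift], [quotient_lift]) then give maps Q -> B(A_n) and
    B(A_n) -> Q, which are inverse to each other because they are so on
    generators.

    For the relations between A and the s_i, consider the chain B_1 = s_1,
    B_(k+1) = B_k ^ s_(k+1), which ends with B_n = A. Two facts are used over
    and over. Conjugation by an element fixes whatever commutes with it, so a
    relation between B_k and some s_i passes to B_(k+1) when s_i commutes with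
    s_(k+1). And if x and y satisfy the braid relation, then x ^ y = y ^ x^-1,
    so B_(k+1) is also s_(k+1) conjugated by the inverse of B_k: this turns a
    relation of s_(k+1) with an element commuting with B_k into a relation of
    B_(k+1). *)

(** * Homomorphisms of groups *)

Section GroupHom.
Variables (G H : groupType) (f : {multiplicative G -> H}).

Lemma hom1 : f 1 = 1.
Proof. by apply: (mulgI (f 1)); rewrite -gmulfM !mulg1. Qed.

(** Between groups, compatibility with products implies compatibility with 1, so
    that the theory of unital morphisms applies to every multiplicative map. *)
Definition umagma_hom : UMagmaMorphism.type G H :=
  HB.pack_for (UMagmaMorphism.type G H) (f : G -> H)
    (isMultiplicative.Build G H f (@gmulfM _ _ f))
    (Multiplicative_isUMagmaMorphism.Build G H f hom1).

Lemma homV : {morph f : x / x^-1}.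
Proof. exact: (@gmulfV _ _ umagma_hom). Qed.

Lemma homF : {morph f : x y / x / y}.
Proof. exact: (@gmulfF _ _ umagma_hom). Qed.

Lemma homJ : {morph f : x y / x ^ y}.
Proof. exact: (@gmulfJ _ _ umagma_hom). Qed.

Lemma hom_prod I r (P : pred I) E :
  f (\prod_(i <- r | P i) E i) = \prod_(i <- r | P i) f (E i).
Proof. exact: (@gmulf_prod _ _ umagma_hom). Qed.

End GroupHom.

(** * Universal properties of presentations and of quotients *)

Definition word_eval (X : Type) (G : groupType) (phi : X -> G) (w : word X) : G :=
  \prod_(p <- w) (if p.2 then (phi p.1)^-1 else phi p.1).

Lemma word_eval_cat (X : Type) (G : groupType) (phi : X -> G) (u v : word X) :
  word_eval phi (u ++ v) = word_eval phi u * word_eval phi v.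
Proof. by rewrite /word_eval big_cat. Qed.

Lemma word_eval_positive (X : Type) (G : groupType) (phi : X -> G) (s : seq X) :
  word_eval phi (positive_word s) = \prod_(x <- s) phi x.
Proof. by rewrite /word_eval big_map. Qed.

Lemma word_eval_cong (X : Type) (R : word X -> word X -> Prop) (G : groupType)
    (phi : X -> G) :
    (forall u v, R u v -> word_eval phi u = word_eval phi v) ->
  forall u v, word_cong R u v -> word_eval phi u = word_eval phi v.
Proof.
move=> Rphi u v; elim=> {u v} //.
- by move=> u v w _ -> _ ->.
- by move=> u u' v v' _ uu' _ vv'; rewrite !word_eval_cat uu' vv'.
- by move=> x b; rewrite /word_eval !big_cons big_nil mulg1; case: b;
    rewrite /= ?mulVg ?mulgV.
Qed.

(** Von Dyck's theorem. *)
Lemma presented_lift (X : choiceType) (R : word X -> word X -> Prop)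
    (G : groupType) (phi : X -> G) :
    (forall u v, R u v -> word_eval phi u = word_eval phi v) ->
  exists f : {multiplicative presented R -> G},
    forall x, f (presented_gen R x) = phi x.
Proof.
move=> Rphi.
pose f (q : presented R) := word_eval phi (repr q).
have fpi w : f (\pi_(presented R)%qT w) = word_eval phi w.
  exact/(word_eval_cong Rphi)/word_cong_repr.
have fM : {morph f : x y / x * y}.
  by move=> x y; rewrite -word_eval_cat -fpi.
exists (HB.pack_for {multiplicative presented R -> G} f
         (isMultiplicative.Build _ _ f fM)) => x /=.
by rewrite fpi word_eval_positive big_seq1.
Qed.

(** The generators of a presented group generate it, in the form that lets a
    morphism be computed on an arbitrary class. *)
Lemma pi_word (X : choiceType) (R : word X -> word X -> Prop) (w : word X) :
  (\pi_(presented R) w)%qT = word_eval (presented_gen R) w.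
Proof.
elim: w => [|[x b] w IH]; first by rewrite /word_eval big_nil.
rewrite -cat1s word_eval_cat -IH -pi_cat; congr (_ * _).
rewrite /word_eval big_seq1; case: b => //=.
by rewrite -[RHS]/(presented_inv _) pi_inverse_word.
Qed.

Lemma presented_hom_ext (X : choiceType) (R : word X -> word X -> Prop)
    (G : groupType) (f g : {multiplicative presented R -> G}) :
  (forall x, f (presented_gen R x) = g (presented_gen R x)) -> f =1 g.
Proof.
move=> fg; elim/quotW => w; rewrite pi_word /word_eval !hom_prod.
by apply: eq_bigr => -[x b] _; case: b; rewrite /= ?homV fg.
Qed.

(** The kernel of phi is a normal subgroup, so it contains the normal closure of
    A as soon as it contains A. *)
Lemma quotient_lift (G H : groupType) (A : set G) (phi : {multiplicative G -> H}) :
    (forall x, A x -> phi x = 1) ->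
  exists f : {multiplicative quotient (normal_closure A) -> H},
    forall x, f (coset _ x) = phi x.
Proof.
move=> phiA; pose N := normal_closure A.
have kerN x : normal_set N x -> phi x = 1.
  move: x; apply: (smallest_sub (X := [set x | phi x = 1]%classic)) => //.
  split=> [|x y /= x1 y1|x y /= x1]; first exact: hom1.
    by rewrite homF x1 y1 divg1.
  by rewrite homJ x1 conj1g.
pose f (q : quotient N) := phi (repr q).
have fcoset x : f (coset N x) = phi x.
  have /eq_coset/kerN : coset N x = coset N (repr (coset N x)).
    by rewrite {2}/coset reprK.
  by rewrite gmulfM homV => /mulg1_eq; rewrite invgK.
have fM : {morph f : x y / x * y}.
  by move=> x y; rewrite -[x]reprK -[y]reprK -!/(coset N _) -cosetM !fcoset gmulfM.
by exists (HB.pack_for {multiplicative quotient N -> H} f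
         (isMultiplicative.Build _ _ f fM)).
Qed.

(** * The braid relations of the conjugated first generator *)

Lemma conj_first_hom (G H : groupType) (f : {multiplicative G -> H}) (n : nat)
    (s : 'I_n -> G) :
  f (conj_first s) = conj_first (f \o s).
Proof.
rewrite /conj_first gmulfM !hom_prod.
by congr (_ * _); apply: eq_bigr => i _ /=; rewrite homV.
Qed.

Section ConjChain.
Variable G : groupType.
Implicit Types (x y z : G) (t : nat -> G).

Definition braided x y := x * y * x = y * x * y.

Lemma braided_sym x y : braided x y -> braided y x.
Proof. exact: esym. Qed.

Lemma braidedJ x y z : braided x y -> braided (x ^ z) (y ^ z).
Proof. by rewrite /braided -!conjMg => ->. Qed.

Lemma commuteJ x y z : commute x y -> commute (x ^ z) (y ^ z).
Proof. by rewrite /commute -!conjMg => ->. Qed.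

Lemma conjg_commute x y : commute x y -> x ^ y = x.
Proof. by move=> xy; rewrite conjgE xy mulKg. Qed.

Lemma braided_conj x y : braided x y -> x ^ y = y ^ x^-1.
Proof.
move=> xy; rewrite !conjgE invgK; apply: (mulgI y); apply: (mulIg x).
by rewrite !mulgA mulgV mul1g mulgVK -xy.
Qed.

Lemma braided_conj2 x y : braided x y -> y ^ (x * y) = x.
Proof. by move=> xy; rewrite conjgM (braided_conj (esym xy)) conjgKV. Qed.

(** The chain B_1, B_2, ... with indices shifted by one; C_k stands below for
    [conj_chain t k], that is B_(k+1). The generators are indexed by nat rather
    than by an ordinal type so that the inductions can stop at any k. *)
Fixpoint conj_chain t k : G :=
  if k is k'.+1 then conj_chain t k' ^ t k else t 0.

Lemma conj_chainE t k : conj_chain t k = t 0 ^ \prod_(1 <= i < k.+1) t i.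
Proof.
elim: k => [|k IH] /=; first by rewrite big_geq // conjg1.
by rewrite big_nat_recr //= conjgM -IH.
Qed.

Variables (n : nat) (t : nat -> G).
Hypothesis t_far : forall i j, i.+1 < j -> j < n -> commute (t i) (t j).
Hypothesis t_braid : forall i, i.+1 < n -> braided (t i) (t i.+1).

(** C_k is a word in t_0, ..., t_k, all far from t_j. *)
Lemma conj_chain_far k j : k.+1 < j -> j < n -> commute (t j) (conj_chain t k).
Proof.
elim: k => [|k IH] kj jn /=; first exact/commute_sym/t_far.
have tk : commute (t j) (t k.+1) by apply/commute_sym/t_far.
by rewrite -[t j](conjg_commute tk); apply/commuteJ/IH/jn/ltnW.
Qed.

(** C_(k+1) and t_(k+2) are the conjugates of t_(k+1) and t_(k+2) by the inverse
    of C_k: the former by the braid relation of C_k and t_(k+1), which is the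
    induction hypothesis, the latter because C_k commutes with t_(k+2). *)
Lemma conj_chain_braid_next k :
  k.+1 < n -> braided (conj_chain t k) (t k.+1).
Proof.
elim: k => [|k IH] kn /=; first exact: t_braid.
rewrite (braided_conj (IH (ltnW kn))).
rewrite -[t k.+2 in X in braided _ X](@conjg_commute _ (conj_chain t k)^-1).
  exact/braidedJ/t_braid.
exact/commuteV/conj_chain_far.
Qed.

(** Conjugate the braid relation of C_(k-1) and t_k by t_k. *)
Lemma conj_chain_braid_last k :
  0 < k -> k < n -> braided (t k) (conj_chain t k).
Proof.
case: k => // k _ kn /=; apply: braided_sym.
rewrite -[t k.+1 in X in braided _ X](conjg_commute (commute_refl _)).
exact/braidedJ/conj_chain_braid_next.
Qed.

(** C_1 = t_0 ^ t_1 is t_1 conjugated by the inverse of t_0, so it stands to t_0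
    as t_1 does; every later conjugation is by an element commuting with t_0. *)
Lemma conj_chain_braid_first k :
  0 < k -> k < n -> braided (t 0) (conj_chain t k).
Proof.
elim: k => // -[|k] IH _ kn /=.
  rewrite (braided_conj (t_braid kn)).
  rewrite -[t 0 in X in braided X _](@conjg_commute _ (t 0)^-1).
    exact/braidedJ/t_braid.
  exact/commuteV/commute_refl.
rewrite -[t 0](@conjg_commute _ (t k.+2)); last exact: t_far.
exact/braidedJ/IH/ltnW.
Qed.

(** When k = i + 1, conjugation by t_i t_(i+1) turns t_(i+1), which commutes with
    C_(i-1), into t_i, and C_(i-1) into C_k; every later conjugation is by an
    element commuting with t_i. *)
Lemma conj_chain_commute i k :
  0 < i -> i < k -> k < n -> commute (t i) (conj_chain t k).
Proof.
move=> i0; elim: k => // k IH; rewrite ltnS leq_eqVlt => /orP[/eqP<-|ik] kn.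
  case: i i0 {IH} kn => // i _ kn /=; rewrite -conjgM.
  rewrite -[t i.+1 in X in commute X _](braided_conj2 (t_braid kn)).
  exact/commuteJ/conj_chain_far.
rewrite /= -[t i](@conjg_commute _ (t k.+1)); last exact: t_far.
exact/commuteJ/IH/ltnW.
Qed.

End ConjChain.

(** The decreasing product of inverses is the inverse of the increasing product,
    so that [conj_first s] is the conjugate of the first generator by the
    product of the others. *)
Lemma conj_firstE (G : groupType) (n : nat) (s : 'I_n.+1 -> G) (t : nat -> G) :
  (forall i : 'I_n.+1, t i = s i) -> conj_first s = conj_chain t n.
Proof.
move=> ts; rewrite conj_chainE /conj_first prodgV revK conjgE.
have -> : \prod_(i <- enum 'I_n.+1 | 0 < i) s i = \prod_(1 <= i < n.+1) t i.
  under eq_bigr do rewrite -ts.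
  rewrite -(big_map val (fun i => 0 < i) t) val_enum_ord big_cons /=.
  rewrite /index_iota subSS subn0 big_seq_cond [RHS]big_seq.
  by apply: eq_bigl => i; rewrite mem_iota; case: (0 < i); rewrite ?andbT ?andbF.
rewrite big_ord_recl -ts big_add1 big_mkord; congr (_ * (_ * _)).
by apply: eq_bigr => i _; rewrite -ts.
Qed.

(** * The affine relations in the braid group *)

Definition braid_of_affine (n : nat) (x : option 'I_n) : braid_group n :=
  if x is Some i then sigma i else conj_first (@sigma n).

Lemma affine_rel_conj_first (n : nat) (u v : word (option 'I_n)) :
  affine_braid_rel u v ->
  word_eval (@braid_of_affine n) u = word_eval (@braid_of_affine n) v.
Proof.
case: n u v => [|n] u v; first by case=> -[].
(* Beyond n the values of t are junk; the lemmas on chains never look there. *)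
pose t k := @sigma n.+1 (inord k).
have tE (i : 'I_n.+1) : t i = sigma i by rewrite /t inord_val.
have -> : @braid_of_affine n.+1 =
    fun x => if x is Some i then sigma i else conj_chain t n.
  by apply/funext => -[i|] //=; apply: conj_firstE.
have sigma_rel (u' v' : seq 'I_n.+1) :
    braid_rel (positive_word u') (positive_word v') ->
    \prod_(i <- u') sigma i = \prod_(i <- v') sigma i.
  by move=> uv; rewrite -!word_eval_positive -!pi_word;
    apply/word_cong_pi/word_cong_rel.
have t_far i j : i.+1 < j -> j < n.+1 -> commute (t i) (t j).
  move=> ij jn; have := @sigma_rel [:: inord i; inord j] [:: inord j; inord i].
  rewrite !big_cons !big_nil !mulg1; apply; apply: braid_comm.
  by rewrite !inordK // ?/far ?ij // (ltn_trans (ltnW ij)).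
have t_braid i : i.+1 < n.+1 -> braided (t i) (t i.+1).
  move=> ij; have := @sigma_rel [:: inord i; inord i.+1; inord i]
                                [:: inord i.+1; inord i; inord i.+1].
  rewrite !big_cons !big_nil !mulg1 !mulgA; apply; apply: braid_braid.
  by rewrite !inordK // ltnW.
case=> [i j ij|i j ij|i i0 ilt|i n1 i0|i n1 ilt];
  rewrite !word_eval_positive !big_cons !big_nil !mulg1 ?mulgA.
- have := @sigma_rel [:: i; j] [:: j; i].
  by rewrite !big_cons !big_nil !mulg1; apply; apply: braid_comm.
- have := @sigma_rel [:: i; j; i] [:: j; i; j].
  by rewrite !big_cons !big_nil !mulg1 !mulgA; apply; apply: braid_braid.
- by rewrite -tE; apply: (conj_chain_commute t_far t_braid).
- by rewrite -tE i0; apply: (conj_chain_braid_first t_far t_braid).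
- have {ilt} iE : i = n :> nat by case: ilt.
  by rewrite -tE iE; apply: (conj_chain_braid_last t_far t_braid).
Qed.

Theorem theorem5p7 (n : nat) (hn : (1 <= n)%N) :
  exists f : {multiplicative Q n -> braid_group n},
    [/\ (forall i : 'I_n, f (coset (N_e n) (affine_sigma i)) = sigma i),
        f (coset (N_e n) (affine_a n)) = conj_first (@sigma n),
        (forall g : {multiplicative Q n -> braid_group n},
           (forall i : 'I_n, g (coset (N_e n) (affine_sigma i)) = sigma i) ->
           g (coset (N_e n) (affine_a n)) = conj_first (@sigma n) ->
           g =1 f)
      & bijective f].
Proof.
have [F Fgen] := presented_lift (@affine_rel_conj_first n).
have Fs i : F (affine_sigma i) = sigma i := Fgen (Some i).
have Fa : F (affine_a n) = conj_first (@sigma n) := Fgen None.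
have Fe x : [set elt_e n]%classic x -> F x = 1.
  move=> ->; rewrite gmulfM homV Fa conj_first_hom.
  by rewrite (_ : _ \o _ = @sigma n) ?mulVg //; apply/funext.
have [f fcoset] := quotient_lift Fe.
(* Cosets of the generators generate Q, hence uniqueness of f and, below, the
   two cancellation laws. *)
have hom_ext (H : groupType) (g h : {multiplicative Q n -> H}) :
    (forall i, g (coset (N_e n) (affine_sigma i)) = h (coset (N_e n) (affine_sigma i))) ->
    g (coset (N_e n) (affine_a n)) = h (coset (N_e n) (affine_a n)) ->
    g =1 h.
  move=> ghs gha; elim/quotW => x.
  by apply: (@presented_hom_ext _ _ _ (g \o coset (N_e n)) (h \o coset (N_e n)))
    => -[i|]; [apply: ghs | apply: gha].
have sQ_rel u v : braid_rel u v ->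
    word_eval (fun i => coset (N_e n) (affine_sigma i)) u =
    word_eval (fun i => coset (N_e n) (affine_sigma i)) v.
  have affine_rel (u' v' : seq 'I_n) :
      affine_braid_rel (positive_word (map Some u')) (positive_word (map Some v')) ->
      word_eval (fun i => coset (N_e n) (affine_sigma i)) (positive_word u') =
      word_eval (fun i => coset (N_e n) (affine_sigma i)) (positive_word v').
    move=> /(word_cong_rel (R := @affine_braid_rel n))/word_cong_pi.
    rewrite !pi_word !word_eval_positive !big_map => /(congr1 (coset (N_e n))).
    by rewrite !hom_prod.
  case=> i j ij; apply: affine_rel; first exact: affine_comm.
  exact: affine_braid.
have [g ggen] := presented_lift sQ_rel.
(* Since e dies in Q, the coset of a_(n+1) is redundant as a generator. *)
have aQ : conj_first (coset (N_e n) \o @affine_sigma n) = coset (N_e n) (affine_a n).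
  rewrite -conj_first_hom; apply/esym/eq_coset.
  exact: (sub_gen_smallest (G := [set elt_e n]%classic)).
exists f; split=> [i||h hs ha|].
- by rewrite fcoset Fs.
- by rewrite fcoset Fa.
- by apply: hom_ext => [i|]; rewrite ?hs ?ha fcoset ?Fs ?Fa.
- exists g.
  + apply: (hom_ext _ (g \o f) idfun) => [i|] /=.
      by rewrite fcoset Fs ggen.
    rewrite fcoset Fa conj_first_hom -aQ.
    by congr conj_first; apply/funext => i; apply: ggen.
  + apply: (@presented_hom_ext _ _ _ (f \o g) idfun) => i /=.
    by rewrite ggen fcoset Fs.
Qed.
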